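(* Let $q\ge 3$ be a prime number. (1) We have $$f_q(x)\equiv c_q\,\mathrm{Li}_{1-q}\left(\frac{-x}{1-x}\right)\mod q^2,\qquad\text{where } c_q=\sum_{j=1}^{q-1}jj^*.$$ (2) Let $m,n\in\mathbb{Z}$ with $m\ne 0$, and assume that $m-n\not\equiv 0\bmod q$. Then the following are equivalent: (a) $\mathrm{Li}_{1-q}\left(\frac{n}{m}\right)\in q^2\mathbb{Z}_{(q)}$; (b) $f_q\left(\frac{-n}{m-n}\right)\in q^2\mathbb{Z}_{(q)}$. (3) We have $$\mathrm{Li}_{1-q}(x^{-1})=-\mathrm{Li}_{1-q}(x),\qquad f_q(1-x)\equiv -f_q(x)\mod q^2.$$ In particular: (a) For $b\in\mathbb{Q}$ with $b\ne 0,1$: $\mathrm{Li}_{1-q}(b)\in q^2\mathbb{Z}_{(q)}$ if and only if $\mathrm{Li}_{1-q}(b^{-1})\in q^2\mathbb{Z}_{(q)}$. (b) For $b\in\mathbb{Z}_{(q)}$: $b\bmod q^2\in S_q$ if and only if $1-b\bmod q^2\in S_q$. (c) For nonzero $m\in\mathbb{Z}$ and $n\in\mathbb{Z}$: $\mathrm{Li}_{1-q}\left(\frac{n}{m}\right)\in q^2\mathbb{Z}_{(q)}$ whenever $\frac{n}{m}\in q^2\mathbb{Z}_{(q)}$, or $\frac{n}{m}\in -1+q^2\mathbb{Z}_{(q)}$, or ($n\neq 0$ and) $\frac{m}{n}\in q^2\mathbb{Z}_{(q)}$. (d) $0,\frac12,1\bmod q^2\in S_q$.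
   Context: $\mathbb{Z}_{(q)}$ denotes the localization of $\mathbb{Z}$ at the prime ideal $q\mathbb{Z}$; elements of $\mathbb{Z}_{(q)}$ are reduced modulo $q^2$ via $\mathbb{Z}_{(q)}/q^2\mathbb{Z}_{(q)}\cong\mathbb{Z}/q^2\mathbb{Z}$. For $a\in\mathbb{Z}_{(q)}$ with $q\nmid a$, $a^*$ is the integer with $1\le a^*\le q-1$ and $aa^*\equiv 1\bmod q$. The polynomial $f_q$ and the set $S_q$ are $$f_q(x):=\sum_{t=1}^{q}\left(\sum_{\substack{1\le j,k,l\le q-1\\ k\equiv jl \bmod q}}(-1)^k\binom{t}{k}jl\right)\frac{x^t}{t}\in\mathbb{Z}_{(q)}[x],$$ $$S_q:=\{a-f_q(a)\bmod q^2\in\mathbb{Z}/q^2\mathbb{Z}\mid a=0,1,\dots,q-1\},$$ where $\binom{t}{k}=0$ for $k>t$. The polylogarithm of negative index is $$\mathrm{Li}_{1-q}(x):=\left(x\frac{d}{dx}\right)^{q-1}\frac{x}{1-x}\in\mathbb{Q}(x).$$ The rational function $\mathrm{Li}_{1-q}\left(\frac{-x}{1-x}\right)$ is a polynomial in $x$ with integer coefficients; congruences modulo $q^2$ between polynomials mean that the coefficients of the difference lie in $q^2\mathbb{Z}_{(q)}$. *)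

(* Defs.v *)
From HB Require Import structures.
From mathcomp Require Import all_boot all_order all_algebra.
From mathcomp Require Import ring.

Set Implicit Arguments.
Unset Strict Implicit.
Unset Printing Implicit Defensive.

Import Order.TTheory GRing.Theory Num.Theory.
Local Open Scope ring_scope.

Notation "p %:FR" := (@FracField.tofrac _ p)
  (at level 2, left associativity, format "p %:FR") : ring_scope.

Section RationalFunctions.
Variable F : fieldType.
Implicit Types (u : {fraction {poly F}}) (n d : {poly F}).

(* The representative [repr u] of a fraction need not be in lowest terms. *)
Lemma frac_reprE u : (\n_(repr u))%:FR = u * (\d_(repr u))%:FR.
Proof.
rewrite -{2}(reprK u); unlock FracField.tofrac; rewrite -[RHS]FracField.pi_mul.
apply/eqmodP => /=; rewrite FracField.equivfE /FracField.mulf /=.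
by rewrite !numden_Ratio ?mulf_neq0 ?oner_neq0 ?denom_ratioP // !mulr1 !mul1r mulrC.
Qed.

Lemma frac_repr_cross u n d : d != 0 -> u = n%:FR / d%:FR ->
  \n_(repr u) * d = n * \d_(repr u).
Proof.
move=> d0 uE; apply/eqP; rewrite -tofrac_eq !tofracM frac_reprE.
by rewrite {1}uE mulrAC divfK // tofrac_eq0.
Qed.

(* Quotient rule; independent of the representative by [fderiv_frac]. *)
Definition fderiv u : {fraction {poly F}} :=
  let n := \n_(repr u) in let d := \d_(repr u) in
  (n^`() * d - n * d^`())%:FR / (d ^+ 2)%:FR.

Lemma fderiv_frac n d : d != 0 ->
  fderiv (n%:FR / d%:FR) = (n^`() * d - n * d^`())%:FR / (d ^+ 2)%:FR.
Proof.
move=> d0; rewrite /fderiv; set u := n%:FR / d%:FR.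
have := frac_repr_cross d0 (erefl u).
have := denom_ratioP (repr u).
set N := \n_(repr u); set D := \d_(repr u) => D0 E.
have E' : N^`() * d + N * d^`() = n^`() * D + n * D^`() by rewrite -!derivM E.
apply/eqP; rewrite eqr_div ?tofrac_eq0 ?expf_neq0 // -!tofracM tofrac_eq.
apply/eqP.
have H1 : N^`() * d = n^`() * D + n * D^`() - N * d^`() by rewrite -E' addrK.
transitivity (N^`() * d * (D * d) - N * d * (d * D^`())); first by ring.
rewrite H1 E; transitivity (n^`() * D * (D * d) + n * D^`() * (D * d)
  - N * d * (D * d^`()) - n * D * (d * D^`())); first by ring.
by rewrite E; ring.
Qed.

(* Value of u at a point z of an extension L of F, given by f : F -> L.
   Taking L = F gives values at scalars, and L = F(x) gives the composition
   of rational functions.  At a pole the value is 0, by the convention 0^-1 = 0. *)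
Definition feval (L : fieldType) (f : {rmorphism F -> L}) u (z : L) : L :=
  let n := \n_(repr u) in let d := \d_(repr u) in
  (map_poly f (n %/ gcdp n d)).[z] / (map_poly f (d %/ gcdp n d)).[z].

Lemma feval_frac (L : fieldType) (f : {rmorphism F -> L}) n d (z : L) :
  (map_poly f d).[z] != 0 ->
  feval f (n%:FR / d%:FR) z = (map_poly f n).[z] / (map_poly f d).[z].
Proof.
move=> dz0; have d0 : d != 0.
  by apply: contraNneq dz0 => ->; rewrite rmorph0 horner0.
rewrite /feval; set u := n%:FR / d%:FR.
have := frac_repr_cross d0 (erefl u); have := denom_ratioP (repr u).
set N := \n_(repr u); set D := \d_(repr u) => D0 E.
set g := gcdp N D; set N' := N %/ g; set D' := D %/ g.
have g0 : g != 0 by rewrite gcdp_eq0 negb_and D0 orbT.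
have NE : N' * g = N by rewrite divpK ?dvdp_gcdl.
have DE : D' * g = D by rewrite divpK ?dvdp_gcdr.
have {}E : N' * d = n * D'.
  by apply: (mulIf g0); rewrite -mulrA [d * g]mulrC mulrA NE -mulrA DE.
have Ez : (map_poly f N').[z] * (map_poly f d).[z]
        = (map_poly f n).[z] * (map_poly f D').[z].
  by rewrite -!hornerM -!rmorphM E.
have D'z : (map_poly f D').[z] != 0.
  apply/negP => /eqP D'z.
  have /eqP := Ez; rewrite D'z mulr0 mulf_eq0 (negPf dz0) orbF => N'z.
  have cop : coprimep (map_poly f N') (map_poly f D').
    by rewrite coprimep_map coprimep_div_gcd // D0 orbT.
  by have := coprimep_root cop N'z; rewrite D'z eqxx.
by apply/eqP; rewrite eqr_div // Ez.
Qed.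

Definition fconst : F -> {fraction {poly F}} := @FracField.tofrac _ \o polyC.
HB.instance Definition _ := GRing.RMorphism.copy fconst
  (@FracField.tofrac {poly F} \o polyC).

Definition fcomp u (v : {fraction {poly F}}) : {fraction {poly F}} :=
  feval fconst u v.

Definition fval u (b : F) : F := feval idfun u b.

End RationalFunctions.

Definition Zloc (q : nat) : {pred rat} := fun x => ~~ (q%:Z %| denq x)%Z.

Lemma ZlocP (q : nat) (x : rat) :
  reflect (exists a s : int, ~~ (q%:Z %| s)%Z /\ x = a%:~R / s%:~R)
          (x \in Zloc q).
Proof.
apply: (iffP idP) => [xq | [a [s [qs ->]]]].
  by exists (numq x), (denq x); split; last by rewrite divq_num_den.
rewrite unfold_in; apply: contra qs => qd; apply: dvdz_trans qd _.
have [->|s0] := eqVneq s 0; first exact: dvdz0.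
set y : rat := _ / _; have : y = a%:~R / s%:~R by [].
rewrite -{1}(divq_num_den y) => /eqP.
rewrite eqr_div ?intr_eq0 ?denq_neq0 // -!intrM eqr_int => /eqP E.
have : (denq y %| numq y * s)%Z by rewrite E dvdz_mull.
by rewrite Gauss_dvdzr // coprimezE coprime_sym coprime_num_den.
Qed.

(* The ideal q^k Z_(q) as a subset of Q. *)
Definition qZloc (q k : nat) : {pred rat} := fun x => x / q%:R ^+ k \in Zloc q.

(* Reduction Z_(q) -> Z/q^2; meaningless outside Z_(q). *)
Definition modq2 (q : nat) (x : rat) : 'Z_(q ^ 2) :=
  (numq x)%:~R / (denq x)%:~R.

Lemma modq2_frac (q : nat) (a s : int) : prime q -> ~~ (q%:Z %| s)%Z ->
  modq2 q (a%:~R / s%:~R) = a%:~R / s%:~R.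
Proof.
move=> pq qs.
have q2 : (1 < q ^ 2)%N by rewrite -(exp1n 2) ltn_exp2r // prime_gt1.
have unit_int t : ~~ (q%:Z %| t)%Z -> (t%:~R : 'Z_(q ^ 2)) \is a GRing.unit.
  have nat_unit m : ~~ (q %| m)%N -> (m%:R : 'Z_(q ^ 2)) \is a GRing.unit.
    by move=> qm; rewrite unitZpE // coprime_sym coprime_pexpr // coprime_sym prime_coprime.
  case: t => m; rewrite dvdzE => H; first exact: nat_unit.
  by rewrite NegzE mulrNz unitrN; apply: nat_unit.
set x : rat := _ / _; rewrite /modq2.
have qd : ~~ (q%:Z %| denq x)%Z.
  by have/ZlocP : exists a0 s0 : int, ~~ (q%:Z %| s0)%Z /\ x = a0%:~R / s0%:~R
    by exists a, s.
have s0 : s != 0 by apply: contraNneq qs => ->; rewrite dvdz0.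
have : x = a%:~R / s%:~R by [].
rewrite -{1}(divq_num_den x) => /eqP.
rewrite eqr_div ?intr_eq0 ?denq_neq0 // -!intrM eqr_int => /eqP E.
apply: (mulIr (unit_int _ qs)); rewrite divrK ?unit_int //.
apply: (mulIr (unit_int _ qd)).
by rewrite mulrAC divrK ?unit_int // -!intrM E.
Qed.

(* The inverse of a modulo q Z_(q) in 1..q-1, and 0 if there is none. *)
Definition qinv (q : nat) (a : rat) : nat :=
  head 0%N [seq s <- iota 1 q.-1 | a * s%:R - 1 \in qZloc q 1].

Definition cq (q : nat) : nat :=
  (\sum_(1 <= j < q) j * qinv q j%:R)%N.

Definition fq (q : nat) : {poly rat} :=
  \sum_(1 <= t < q.+1)
    ((\sum_(1 <= j < q) \sum_(1 <= k < q)
        \sum_(1 <= l < q | (k == j * l %[mod q])%N)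
          (-1) ^+ k * 'C(t, k)%:R * j%:R * l%:R) / t%:R) *: 'X^t.

Definition Sq (q : nat) : {set 'Z_(q ^ 2)} :=
  [set modq2 q (a%:R - (fq q).[a%:R]) | a : 'I_q].

(* Polylogarithm of index -k, as a rational function over Q. *)
Definition Lineg (k : nat) : {fraction {poly rat}} :=
  iter k (fun u => 'X%:FR * fderiv u) ('X%:FR / (1 - 'X)%:FR).

(* Main.v *)
Require Import Defs.
From HB Require Import structures.
From mathcomp Require Import all_boot all_order all_algebra.
From mathcomp Require Import ring.

Set Implicit Arguments.
Unset Strict Implicit.
Unset Printing Implicit Defensive.

Import Order.TTheory GRing.Theory Num.Theory.
Local Open Scope ring_scope.

(** Put y = -x/(1-x).  This change of variable is an involution, and it turns
    the operator y d/dy into D = x(1-x) d/dx; since y/(1-y) = -x, the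
    polylogarithm of index -k becomes the integer polynomial P_k = D^k(-x)
    ([lipoly k]).  As rational functions have to be evaluated at arbitrary points
    too, this is proved by writing the polylogarithm as the homogenisation of P_k
    in -X and 1-X over (1-X)^(k+1) ([Lineg_homog], [feval_Lineg]).

    Two properties of P_k give most of the theorem.  The recurrence for its
    coefficients is solved by t P_k[t] = sum_j (-1)^j C(t,j) j^(k+1)
    ([coef_lipoly]), and the substitution x -> 1-x, which corresponds to
    y -> 1/y, maps D to -D, so that P_k(1-x) = -P_k(x) for even k > 0
    ([lipoly_refl]).

    Let P = P_(q-1), and let A_k be the sum of j l over the pairs of nonzero
    residues with j l = k modulo q.  Up to a multiple of q^2 coming from the term
    k = q, the coefficients of f_q - c_q P are
    (1/t) sum_k (-1)^k C(t,k) (A_k - c_q k^q), so the congruence (1) follows from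
    A_k = c_q k^q modulo q^2 ([pairsum_modq2]).  For this write each residue as
    j = j^q u_j modulo q^2 with u_j = 1 modulo q.  For such units
    u_j u_l = u_j + u_l - 1, and j l contributes k^q (u_j + u_l - 1); the sum of
    the second factors over all pairs does not depend on k, because each j and
    each l occurs exactly once, and k = 1 identifies it as c_q.

    The remaining claims are computations in Z/q^2, to which Z_(q) maps by the ring
    morphism [modq2] with kernel q^2 Z_(q).  The constant c_q is -1 modulo q,
    hence a unit, which gives (2).  Modulo q, Fermat's little theorem identifies
    the coefficients t P_k[t] for k = q-1 with those for k = 0, so P' = -1
    modulo q, and the map g(r) = r - c_q P(r) on Z/q^2 only depends on r modulo q
    ([sub_fqR_addq]).  Therefore S_q is the whole image of g, and g(1-r) = 1 - g(r)
    shows that S_q is stable under b -> 1-b.  At a point with r = 1-r, such as 1/2,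
    P vanishes and g(r) = r. *)

Local Notation PolyQ p := (map_poly (intr : int -> rat) p).

(** * The polylogarithm polynomials *)

(** The operator x(1-x) d/dx is y d/dy in the coordinate y = -x/(1-x), and -x is
    y/(1-y). *)
Fixpoint lipoly (k : nat) : {poly int} :=
  if k is k'.+1 then 'X * (1 - 'X) * (lipoly k')^`() else - 'X.

Lemma lipolyS k : lipoly k.+1 = 'X * (1 - 'X) * (lipoly k)^`().
Proof. by []. Qed.

Lemma coef_X1X_deriv (S : comNzRingType) (p : {poly S}) t :
  ('X * (1 - 'X) * p^`())`_t = t%:R * p`_t - t.-1%:R * p`_t.-1.
Proof.
rewrite mulrBr mulr1 mulrBl coefB -expr2 coefXM coefXnM.
case: t => [|[|t]] /=; first by rewrite !mul0r.
  by rewrite coef_deriv !mulr1n mul1r mul0r !subr0.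
by rewrite !coef_deriv subn2 /= -!(mulr_natl p`__).
Qed.

Lemma size_lipoly k : (size (lipoly k) <= k.+2)%N.
Proof.
elim: k => [|k IH]; first by rewrite size_polyN size_polyX.
apply/leq_sizeP => -[//|j] kj; rewrite lipolyS coef_X1X_deriv /=.
by rewrite !(leq_sizeP _ _ IH) ?mulr0 ?subr0 //; exact: ltnW.
Qed.

Lemma lipoly_coef0 k : (lipoly k)`_0 = 0.
Proof.
case: k => [|k]; first by rewrite coefN coefX oppr0.
by rewrite lipolyS coef_X1X_deriv !mul0r subr0.
Qed.

(** Both sides satisfy c_(k+1)(t) = t (c_k(t) - c_k(t-1)): on the right by
    C(t,j) - C(t-1,j) = C(t-1,j-1) and t C(t-1,j-1) = j C(t,j). *)
Lemma coef_lipoly k t :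
  t%:R * (lipoly k)`_t = \sum_(j < t.+1) (-1) ^+ j * 'C(t, j)%:R * j%:R ^+ k.+1.
Proof.
elim: k t => [|k IH] t.
  rewrite big_ord_recl mulr0 add0r.
  case: t => [|t]; first by rewrite big_ord0 mul0r.
  have -> : \sum_(i < t.+1)
       (-1) ^+ bump 0 i * 'C(t.+1, bump 0 i)%:R * (bump 0 i)%:R ^+ 1
     = - t.+1%:R * \sum_(i < t.+1) ((-1) ^+ i *+ 'C(t, i)) :> int.
    rewrite mulr_sumr; apply: eq_bigr => i _; rewrite /bump add1n expr1.
    rewrite -mulrA -natrM mulnC -mul_bin_diag /= natrM -mulr_natl exprS; ring.
  have -> : \sum_(i < t.+1) ((-1) ^+ i *+ 'C(t, i)) = (t == 0%N)%:R :> int.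
    rewrite -[RHS](expr0n _ t) -[0 in RHS](subrr (1 : int)) exprBn.
    by apply: eq_bigr => i _; rewrite !expr1n !mulr1.
  by rewrite /= coefN coefX eqSS mulrN mulNr.
rewrite lipolyS coef_X1X_deriv mulrBr !IH -mulrBr; case: t => [|t] /=.
  by rewrite mul0r big_ord_recl big_ord0 exprS mul0r mulr0.
(* The sum for t is extended by the zero term j = t+1. *)
have -> : \sum_(j < t.+1) (-1) ^+ j * 'C(t, j)%:R * j%:R ^+ k.+1 =
  \sum_(j < t.+2) (-1) ^+ j * 'C(t, j)%:R * j%:R ^+ k.+1 :> int.
  by rewrite [RHS]big_ord_recr /= bin_small // mulr0 mul0r addr0.
rewrite -sumrB mulr_sumr; apply: eq_bigr => -[[|j] /= _] _.
  by rewrite !bin0 subrr mulr0 [_ ^+ k.+2]exprS mul0r mulr0.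
rewrite binS natrD; have := mul_bin_diag t.+1 j; rewrite /= => /(congr1 (fun n => n%:R : int)).
rewrite !natrM binS natrD => E.
transitivity ((-1) ^+ j.+1 * (t.+1%:R * 'C(t, j)%:R) * j.+1%:R ^+ k.+1 : int); first by ring.
by rewrite E [_ ^+ k.+2]exprS; ring.
Qed.

(** The substitution x -> 1-x maps x(1-x) d/dx to its opposite, and -x to
    -1 - (-x), whose constant disappears after one differentiation. *)
Lemma lipoly_refl k : lipoly k.+1 \Po (1 - 'X) = (-1) ^+ k * lipoly k.+1.
Proof.
elim: k => [|k IH].
  rewrite /= derivN derivX !rmorphM rmorphB /= rmorphN !rmorph1 comp_polyX /=.
  by ring.
have := congr1 (@deriv _) IH; rewrite deriv_comp derivB derivC derivX sub0r.
rewrite mulrN1 => /(canRL (@opprK _)) E.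
have sgn : (-1) ^+ k = ((-1) ^+ k)%:P :> {poly int} by rewrite rmorphXn rmorphN1.
rewrite lipolyS comp_polyM E sgn derivM derivC mul0r add0r -sgn exprS.
by rewrite comp_polyM comp_polyB comp_polyX rmorph1; ring.
Qed.

Lemma lipoly_refl_even k : ~~ odd k -> (0 < k)%N ->
  lipoly k \Po (1 - 'X) = - lipoly k.
Proof.
case: k => // k; rewrite /= negbK => ok _.
by rewrite -/(lipoly k.+1) lipoly_refl -signr_odd ok mulN1r.
Qed.

Lemma horner_lipoly_refl k (S : comNzRingType) (y : S) : ~~ odd k -> (0 < k)%N ->
  (map_poly intr (lipoly k)).[1 - y] = - (map_poly intr (lipoly k)).[y].
Proof.
move=> ev k0.
have := congr1 (fun p => (map_poly (intr : int -> S) p).[y]) (lipoly_refl_even ev k0).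
by rewrite map_comp_poly horner_comp rmorphN hornerN rmorphB rmorph1 /= map_polyX !hornerE.
Qed.

(** * Polylogarithms as rational functions *)

Section Homog.
Variable F : fieldType.
Implicit Type p : {poly F}.

(** The numerator of p(x/(x-1)) over (1-x)^n, when p has degree at most n. *)
Definition homog n p : {poly F} :=
  \sum_(t < n.+1) p`_t *: ((- 'X) ^+ t * (1 - 'X) ^+ (n - t)).

Lemma theta_homog_monom s t :
  'X * ((1 - 'X) * ((- 'X) ^+ t * (1 - 'X) ^+ s)^`()
        + (t + s)%:R * ((- 'X) ^+ t * (1 - 'X) ^+ s))
  = t%:R * ((- 'X) ^+ t * (1 - 'X) ^+ s) :> {poly F}.
Proof.
have d1 : 'X * ((- 'X) ^+ t)^`() = t%:R * (- 'X) ^+ t :> {poly F}.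
  case: t => [|t]; first by rewrite expr0 derivC mulr0 mul0r.
  by rewrite deriv_exp derivN derivX /= exprS -mulr_natl; ring.
have d2 : (1 - 'X) * ((1 - 'X) ^+ s)^`() = - s%:R * (1 - 'X) ^+ s :> {poly F}.
  case: s => [|s]; first by rewrite expr0 derivC mulr0 oppr0 mul0r.
  by rewrite deriv_exp derivB derivC derivX /= exprS -mulr_natl; ring.
rewrite derivM natrD.
set a := (- 'X) ^+ t in d1 *; set b := (1 - 'X) ^+ s in d2 *.
transitivity ((1 - 'X) * b * ('X * a^`()) + 'X * a * ((1 - 'X) * b^`())
  + (t%:R + s%:R) * 'X * a * b); first by ring.
by rewrite d1 d2; ring.
Qed.

(** The quotient rule for X d/dX, with the common factor of numerator and
    denominator cancelled: the derivative of homog n p / (1-X)^n has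
    denominator (1-X)^(n+1) instead of (1-X)^(2n). *)
Lemma theta_homog n p : (size p <= n.+1)%N ->
  'X * ((1 - 'X) * (homog n p)^`() + n%:R * homog n p)
  = homog n.+1 ('X * (1 - 'X) * p^`()).
Proof.
move=> sp.
have -> : homog n.+1 ('X * (1 - 'X) * p^`()) =
    \sum_(t < n.+1) p`_t *: (t%:R * ((- 'X) ^+ t * (1 - 'X) ^+ (n - t))).
  have E (t : 'I_n.+2) : ('X * (1 - 'X) * p^`())`_t =
      p`_t * t%:R - p`_t.-1 * t.-1%:R.
    by rewrite coef_X1X_deriv ![_%:R * _]mulrC.
  (* The two shifted sums combine through (1-X) m - (-X) m = m. *)
  rewrite /homog; under eq_bigr => t _ do rewrite E scalerBl.
  rewrite sumrB big_ord_recr /= (leq_sizeP _ _ sp) // mul0r scale0r addr0.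
  rewrite [X in _ - X]big_ord_recl /= mulr0 scale0r add0r -sumrB; apply: eq_bigr => t _.
  rewrite /bump add1n /= subSS subSn ?leq_ord // -scalerBr.
  rewrite -scalerA scaler_nat mulr_natl !exprS; congr (_ *: (_ *+ _)); ring.
rewrite raddf_sum !mulr_sumr -big_split mulr_sumr /=; apply: eq_bigr => t _.
rewrite derivZ -!scalerAr -scalerDr -scalerAr; congr (_ *: _).
by have := theta_homog_monom (n - t) t; rewrite subnKC ?leq_ord.
Qed.

Lemma horner_homog (L : fieldType) (f : {rmorphism F -> L}) n p z :
  (size p <= n.+1)%N -> z != 1 ->
  (map_poly f (homog n p)).[z] / (1 - z) ^+ n = (map_poly f p).[z / (z - 1)].
Proof.
move=> sp z1; have z0 : 1 - z != 0 by rewrite subr_eq0 eq_sym.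
rewrite [RHS](@horner_coef_wide _ n.+1); last by rewrite size_map_poly.
rewrite rmorph_sum horner_sum mulr_suml; apply: eq_bigr => t _.
rewrite /= map_polyZ hornerZ coef_map -mulrA; congr (_ * _).
rewrite rmorphM !rmorphXn rmorphB rmorphN rmorph1 /= map_polyX hornerM !horner_exp.
rewrite !hornerE -[in _ ^+ n](subnKC (leq_ord t)) exprD -(opprB 1 z) invrN mulrN.
rewrite -mulNr exprMn exprVn; field.
by rewrite !expf_neq0.
Qed.
End Homog.

(** The numerator is homogenised in degree k+1, the degree of [lipoly k]. *)
Lemma Lineg_homog k :
  Lineg k = (homog k.+1 (PolyQ (lipoly k)))%:FR / ((1 - 'X) ^+ k.+1)%:FR.
Proof.
have X1 : 1 - 'X != 0 :> {poly rat}.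
  by rewrite -opprB oppr_eq0 polyXsubC_eq0.
elim: k => [|k IH].
  rewrite /Lineg /= /homog 2!big_ord_recl big_ord0 /= rmorphN /= map_polyX.
  by rewrite !coefN !coefX !expr1 !mulr1 oppr0 scale0r add0r addr0 scaleN1r opprK.
rewrite [LHS]iterS -/(Lineg k) IH fderiv_frac ?expf_neq0 //.
rewrite mulrA -tofracM; apply/eqP.
rewrite eqr_div ?tofrac_eq0 ?expf_neq0 // -!tofracM tofrac_eq; apply/eqP.
rewrite lipolyS !rmorphM rmorphB rmorph1 /= map_polyX -deriv_map -theta_homog; last first.
  by rewrite size_map_inj_poly ?size_lipoly //; apply: intr_inj.
set N := homog _ _; rewrite deriv_exp derivB derivC derivX /= -mulr_natl !exprS.
ring.
Qed.

(** The inverse of x -> -x/(1-x) is that same map z -> z/(z-1), so this reads off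
    the polylogarithm in the new coordinate.  The field L is Q for values and
    Q(x) for compositions. *)
Lemma feval_Lineg k (L : fieldType) (f : {rmorphism rat -> L}) z : z != 1 ->
  feval f (Lineg k) z = (map_poly f (PolyQ (lipoly k))).[z / (z - 1)].
Proof.
move=> z1.
have Dz : (map_poly f ((1 - 'X) ^+ k.+1)).[z] = (1 - z) ^+ k.+1.
  by rewrite rmorphXn rmorphB rmorph1 /= map_polyX horner_exp !hornerE.
rewrite Lineg_homog feval_frac Dz; last by rewrite expf_neq0 // subr_eq0 eq_sym.
apply: horner_homog => //.
by rewrite size_map_inj_poly ?size_lipoly //; apply: intr_inj.
Qed.

Lemma map_fconst_frac (F : fieldType) (p : {poly F}) :
  (map_poly (@fconst F) p).['X%:FR] = p%:FR.
Proof.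
rewrite (map_poly_comp (@FracField.tofrac _) polyC) horner_map /=.
by rewrite -[in RHS](comp_polyXr p).
Qed.

Section Mobius.
Variable F : fieldType.
Implicit Type y : F.

Lemma onem_neq0 y : 1 - y != 0 -> y != 1.
Proof. by rewrite subr_eq0 eq_sym. Qed.

Lemma mobius_neq1 y : 1 - y != 0 -> - y / (1 - y) != 1.
Proof.
move=> y1; rewrite -subr_eq0 (_ : _ - 1 = - (1 - y)^-1) ?oppr_eq0 ?invr_eq0 //.
by field.
Qed.

Lemma mobiusK y : 1 - y != 0 -> (- y / (1 - y)) / (- y / (1 - y) - 1) = y.
Proof.
move=> y1; rewrite (_ : _ - 1 = - (1 - y)^-1); last by field.
by field; rewrite y1 oppr_eq0 oner_eq0.
Qed.

(** In the coordinate z/(z-1), inversion is the reflection x -> 1-x. *)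
Lemma mobius_inv y : y != 0 -> 1 - y != 0 ->
  y^-1 / (y^-1 - 1) = 1 - y / (y - 1).
Proof.
move=> y0 y1; have y1' : y - 1 != 0 by rewrite -opprB oppr_eq0.
by field; rewrite y0 y1' mulN1r y1.
Qed.
End Mobius.

Section Comp.
Let x : {fraction {poly rat}} := 'X%:FR.
Let x1 : 1 - x != 0.
Proof.
by rewrite -[1]tofrac1 -tofracB tofrac_eq0 -opprB oppr_eq0 polyXsubC_eq0.
Qed.
Let x0 : x != 0.
Proof. by rewrite tofrac_eq0 polyX_eq0. Qed.

Lemma fcomp_Lineg_mobius k :
  fcomp (Lineg k) (- x / (1 - x)) = (PolyQ (lipoly k))%:FR.
Proof.
rewrite /fcomp (feval_Lineg _ _ (mobius_neq1 x1)) (mobiusK x1).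
exact: map_fconst_frac.
Qed.

Lemma LinegE k :
  Lineg k = (map_poly (@fconst rat) (PolyQ (lipoly k))).[x / (x - 1)].
Proof.
have xn1 : x != 1 := onem_neq0 x1.
have Dx : (map_poly (@fconst rat) ((1 - 'X) ^+ k.+1)).[x] != 0.
  rewrite map_fconst_frac tofrac_eq0.
  by rewrite expf_neq0 // -opprB oppr_eq0 polyXsubC_eq0.
rewrite -(feval_Lineg k _ xn1) [in RHS]Lineg_homog (feval_frac _ Dx).
by rewrite !map_fconst_frac; apply: Lineg_homog.
Qed.

Lemma fcomp_Lineg_inv k : ~~ odd k -> (0 < k)%N ->
  fcomp (Lineg k) x^-1 = - Lineg k.
Proof.
move=> ev k0; have x'n1 : x^-1 != 1 by rewrite invr_eq1 (onem_neq0 x1).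
rewrite /fcomp (feval_Lineg _ _ x'n1) (mobius_inv x0 x1).
have E (y : {fraction {poly rat}}) :
    (map_poly (@fconst rat) (PolyQ (lipoly k))).[y] = (map_poly intr (lipoly k)).[y].
  rewrite -map_poly_comp; congr horner; apply: eq_map_poly => n /=.
  by rewrite rmorph_int.
by rewrite LinegE !E (horner_lipoly_refl _ ev k0).
Qed.
End Comp.

Lemma fval_Lineg k (b : rat) : b != 1 ->
  fval (Lineg k) b = (PolyQ (lipoly k)).[b / (b - 1)].
Proof. by move=> b1; rewrite /fval feval_Lineg // map_poly_id. Qed.

(** * Reduction from Z_(q) to Z/q^2 *)

Section Arith.
Variables (q : nat) (pq : prime q).
Local Notation R := 'Z_(q ^ 2).

Lemma q2_gt1 : (1 < q ^ 2)%N.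
Proof. by rewrite -(exp1n 2) ltn_exp2r // prime_gt1. Qed.

Lemma natR_eq0 n : (n%:R == 0 :> R) = (q ^ 2 %| n)%N.
Proof. by rewrite -val_eqE /= val_Zp_nat ?q2_gt1. Qed.

Lemma intR_eq0 (n : int) : (n%:~R == 0 :> R) = (q ^ 2 %| `|n|)%N.
Proof.
by case: n => n; rewrite ?NegzE ?mulrNz ?oppr_eq0 natR_eq0 ?abszN.
Qed.

Lemma intR_unit (n : int) : ((n%:~R : R) \is a GRing.unit) = ~~ (q %| `|n|)%N.
Proof.
have H m : ((m%:R : R) \is a GRing.unit) = ~~ (q %| m)%N.
  by rewrite unitZpE ?q2_gt1 // coprime_pexpl // prime_coprime.
by case: n => n; rewrite ?NegzE ?mulrNz ?unitrN H ?abszN.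
Qed.

Lemma mulqR_eq0 (n : int) : (q%:R * n%:~R == 0 :> R) = (q %| `|n|)%N.
Proof.
by rewrite -[q%:R]/(q%:~R) -intrM intR_eq0 abszM expnS expn1 dvdn_pmul2l ?prime_gt0.
Qed.

Lemma Zloc_modq2P (x : rat) : x \in Zloc q -> exists a s : int,
  [/\ ~~ (q%:Z %| s)%Z, x = a%:~R / s%:~R, (s%:~R : R) \is a GRing.unit,
    (s%:~R : rat) != 0
    & modq2 q x = a%:~R / s%:~R].
Proof.
case/ZlocP => a [s [qs ->]]; exists a, s; split => //.
- by rewrite intR_unit -[q]/(`|q%:Z|)%N -dvdzE.
- by rewrite intr_eq0; apply: contraNneq qs => ->; rewrite dvdz0.
- exact: modq2_frac.
Qed.

Lemma dvdq_mul (s t : int) : ~~ (q%:Z %| s)%Z -> ~~ (q%:Z %| t)%Z -> ~~ (q%:Z %| s * t)%Z.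
Proof. by rewrite !dvdzE abszM Euclid_dvdM // negb_or => -> ->. Qed.

Lemma dvdq1 : ~~ (q%:Z %| 1)%Z.
Proof. by rewrite dvdzE dvdn1; case: q pq => [|[]]. Qed.

(** [modq2] is only meaningful on Z_(q), so each compatibility with a ring
    operation comes together with the closure of Z_(q) under it. *)
Lemma Zloc_modq2D x y : x \in Zloc q -> y \in Zloc q ->
  x + y \in Zloc q /\ modq2 q (x + y) = modq2 q x + modq2 q y.
Proof.
move=> /Zloc_modq2P [a [s [qs -> us s0 ->]]] /Zloc_modq2P [b [t [qt -> ut t0 ->]]].
have -> : a%:~R / s%:~R + b%:~R / t%:~R = (a * t + b * s)%:~R / (s * t)%:~R :> rat.
  by rewrite !(intrD, intrM); field; rewrite s0 t0.
split; first by apply/ZlocP; exists (a * t + b * s), (s * t); rewrite dvdq_mul.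
rewrite modq2_frac ?dvdq_mul //.
have u : ((s * t)%:~R : R) \is a GRing.unit by rewrite intrM unitrM us.
apply: (mulIr u); rewrite divrK // !(intrD, intrM).
have := divrK us a%:~R; have := divrK ut b%:~R.
by move: (_ / _) (_ / _) => v w <- <-; ring.
Qed.

Lemma Zloc_modq2M x y : x \in Zloc q -> y \in Zloc q ->
  x * y \in Zloc q /\ modq2 q (x * y) = modq2 q x * modq2 q y.
Proof.
move=> /Zloc_modq2P [a [s [qs -> us s0 ->]]] /Zloc_modq2P [b [t [qt -> ut t0 ->]]].
have -> : a%:~R / s%:~R * (b%:~R / t%:~R) = (a * b)%:~R / (s * t)%:~R :> rat.
  by rewrite !intrM; field; rewrite s0 t0.
split; first by apply/ZlocP; exists (a * b), (s * t); rewrite dvdq_mul.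
rewrite modq2_frac ?dvdq_mul //.
have u : ((s * t)%:~R : R) \is a GRing.unit by rewrite intrM unitrM us.
apply: (mulIr u); rewrite divrK // !intrM.
have := divrK us a%:~R; have := divrK ut b%:~R.
by move: (_ / _) (_ / _) => v w <- <-; ring.
Qed.

Lemma Zloc_modq2_int (n : int) : n%:~R \in Zloc q /\ modq2 q n%:~R = n%:~R.
Proof.
have -> : n%:~R = n%:~R / 1%:~R :> rat by rewrite divr1.
split; first by apply/ZlocP; exists n, 1; rewrite dvdq1.
by rewrite modq2_frac ?dvdq1 // divr1.
Qed.

Lemma Zloc_modq2_1 : 1 \in Zloc q /\ modq2 q 1 = 1.
Proof. exact: (Zloc_modq2_int 1). Qed.

Lemma Zloc_modq2B x y : x \in Zloc q -> y \in Zloc q ->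
  x - y \in Zloc q /\ modq2 q (x - y) = modq2 q x - modq2 q y.
Proof.
move=> zx zy; have [zN mN] := Zloc_modq2_int (-1).
have [zNy mNy] := Zloc_modq2M zN zy.
rewrite -mulN1r; have [-> ->] := Zloc_modq2D zx zNy.
by rewrite mNy mN mulN1r.
Qed.

Lemma qZloc2E x : (x \in qZloc q 2) = (x \in Zloc q) && (modq2 q x == 0).
Proof.
have q0 : (q%:R : rat) != 0 by rewrite pnatr_eq0 -lt0n prime_gt0.
apply/idP/andP => [qx|[]].
  have -> : x = ((q ^ 2)%N%:Z)%:~R * (x / q%:R ^+ 2).
    by rewrite -[_%:~R]/((q ^ 2)%N%:R) natrX mulrC divfK ?expf_neq0.
  have [zi mi] := Zloc_modq2_int (q ^ 2)%N.
  have [z ->] := Zloc_modq2M zi qx.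
  by split => //; rewrite mi -[_%:~R]/((q ^ 2)%N%:R) pchar_Zp ?q2_gt1 // mul0r.
move=> /Zloc_modq2P [a [s [qs -> us s0 ->]]].
rewrite -(inj_eq (mulIr us)) divrK // mul0r intR_eq0.
rewrite -[(q ^ 2)%N]/(`|(q ^ 2)%N%:Z|)%N -dvdzE => /dvdzP [b ->].
rewrite unfold_in; apply/ZlocP; exists b, s; split => //.
rewrite intrM -[(q ^ 2)%N%:~R]/((q ^ 2)%N%:R) natrX; field.
by rewrite s0 q0.
Qed.

Lemma qZlocW x : x \in qZloc q 2 -> x \in Zloc q.
Proof. by rewrite qZloc2E => /andP []. Qed.

Lemma qZlocD x y : x \in qZloc q 2 -> y \in qZloc q 2 -> x + y \in qZloc q 2.
Proof.
rewrite !qZloc2E => /andP [zx /eqP mx] /andP [zy /eqP my].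
by have [-> ->] := Zloc_modq2D zx zy; rewrite mx my addr0 eqxx.
Qed.

Lemma qZlocM x y : x \in qZloc q 2 -> y \in Zloc q -> x * y \in qZloc q 2.
Proof.
rewrite !qZloc2E => /andP [zx /eqP mx] zy.
by have [-> ->] := Zloc_modq2M zx zy; rewrite mx mul0r eqxx.
Qed.

Lemma qZloc0 : 0 \in qZloc q 2.
Proof.
by rewrite qZloc2E -[0 : rat]/(0%:~R); have [-> ->] := Zloc_modq2_int 0.
Qed.

Lemma qZlocN x : x \in qZloc q 2 -> - x \in qZloc q 2.
Proof.
by move=> qx; rewrite -mulrN1 qZlocM //; have [] := Zloc_modq2_int (-1).
Qed.

Lemma qZloc_sum (I : Type) (r : seq I) (C : pred I) (F : I -> rat) :
  (forall i, C i -> F i \in qZloc q 2) -> \sum_(i <- r | C i) F i \in qZloc q 2.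
Proof.
move=> H; elim/big_ind: _ => //; first exact: qZloc0.
exact: qZlocD.
Qed.

Lemma Zloc_modq2_horner (p : {poly int}) x : x \in Zloc q ->
  (PolyQ p).[x] \in Zloc q /\
  modq2 q (PolyQ p).[x] = (map_poly (intr : int -> R) p).[modq2 q x].
Proof.
move=> zx; elim/poly_ind: p => [|p n [zp mp]].
  by rewrite !rmorph0 !horner0; apply: (Zloc_modq2_int 0).
rewrite !rmorphD !rmorphM /= !map_polyX !map_polyC !hornerMXaddC /=.
have [zn <-] := Zloc_modq2_int n.
have [zpx mpx] := Zloc_modq2M zp zx.
by have [-> ->] := Zloc_modq2D zpx zn; rewrite mpx mp.
Qed.

Lemma Zloc_exp x n : x \in Zloc q -> x ^+ n \in Zloc q.
Proof.
move=> zx; elim: n => [|n IH]; first by have [] := Zloc_modq2_int 1.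
by rewrite exprS; have [] := Zloc_modq2M zx IH.
Qed.

Lemma qZloc_coef (p : {poly rat}) i : p \is a polyOver (qZloc q 2) ->
  p`_i \in qZloc q 2.
Proof.
move=> /allP /= qp; have [ip|pi] := ltnP i (size p); first exact/qp/mem_nth.
by rewrite nth_default // qZloc0.
Qed.

Lemma qZloc_polyD (p r : {poly rat}) : p \is a polyOver (qZloc q 2) ->
  r \is a polyOver (qZloc q 2) -> p + r \is a polyOver (qZloc q 2).
Proof.
move=> qp qr; apply/(all_nthP 0) => i _ /=.
by rewrite coefD; apply: qZlocD; apply: qZloc_coef.
Qed.

Lemma qZloc_horner (p : {poly rat}) x : p \is a polyOver (qZloc q 2) ->
  x \in Zloc q -> p.[x] \in qZloc q 2.
Proof.
move=> qp zx; rewrite horner_coef; apply: qZloc_sum => i _.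
by rewrite qZlocM ?Zloc_exp // qZloc_coef.
Qed.

Lemma qZloc_comp (p : {poly rat}) (r : {poly int}) : p \is a polyOver (qZloc q 2) ->
  p \Po PolyQ r \is a polyOver (qZloc q 2).
Proof.
move=> qp; apply/(all_nthP 0) => i _.
rewrite coef_comp_poly; apply: qZloc_sum => j _.
rewrite -rmorphXn coef_map /= qZlocM ?qZloc_coef //.
by have [] := Zloc_modq2_int (r ^+ j)`_i.
Qed.

Lemma Zloc_inv x : x \in Zloc q -> (modq2 q x) \is a GRing.unit ->
  x^-1 \in Zloc q /\ modq2 q x^-1 = (modq2 q x)^-1.
Proof.
case/Zloc_modq2P => a [s [qs -> us s0 ->]].
rewrite unitrMl ?unitrV // => ua; have qa : ~~ (q%:Z %| a)%Z.
  by move: ua; rewrite intR_unit dvdzE.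
rewrite invf_div; split; first by apply/ZlocP; exists s, a.
by rewrite modq2_frac // invrM ?unitrV // invrK.
Qed.

Lemma Zloc_mobius b : b \in Zloc q -> (modq2 q b - 1) \is a GRing.unit ->
  [/\ b != 1, b / (b - 1) \in Zloc q &
      modq2 q (b / (b - 1)) = modq2 q b / (modq2 q b - 1)].
Proof.
move=> zb ub; have [z1 m1] := Zloc_modq2_1.
have b1 : b != 1 by apply: contraTneq ub => ->; rewrite m1 subrr unitr0.
have [zb1 mb1] := Zloc_modq2B zb z1; rewrite m1 in mb1.
have ub1 : modq2 q (b - 1) \is a GRing.unit by rewrite mb1.
have [zi mi] := Zloc_inv zb1 ub1.
by have [zm ->] := Zloc_modq2M zb zi; rewrite mi mb1.
Qed.
End Arith.

(** * Sums over pairs of residues with a given product *)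

Section NumberTheory.
Variables (q : nat) (pq : prime q).
Local Notation R := 'Z_(q ^ 2).

Lemma mulqq : q%:R * q%:R = 0 :> R.
Proof. by rewrite -natrM -[(q * q)%N]/(q ^ 2)%N pchar_Zp ?q2_gt1. Qed.

Lemma mulqR_eqmod (a b : nat) : (a == b %[mod q])%N ->
  q%:R * a%:R = q%:R * b%:R :> R.
Proof.
move=> ab; apply/eqP; rewrite -subr_eq0 -mulrBr.
rewrite -[a%:R]/(a%:~R) -[b%:R]/(b%:~R) -intrB mulqR_eq0 //.
by rewrite -[q]/(`|q%:Z|)%N -dvdzE -eqz_mod_dvd !modz_nat.
Qed.

Lemma natR_subq (a b : nat) : (a == b %[mod q])%N ->
  exists e : int, a%:R - b%:R = q%:R * e%:~R :> R.
Proof.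
move=> ab; have : (q%:Z %| a%:Z - b%:Z)%Z.
  by rewrite -eqz_mod_dvd !modz_nat eqz_nat.
case/dvdzP => e E; exists e.
by rewrite -[a%:R]/(a%:~R) -[b%:R]/(b%:~R) -intrB E intrM mulrC.
Qed.

(** The difference a^q - b^q is (a - b) times a sum of q terms that agree
    modulo q. *)
Lemma expq_eqmod (a b : nat) : (a == b %[mod q])%N -> a%:R ^+ q = b%:R ^+ q :> R.
Proof.
move=> ab; apply/eqP; rewrite -subr_eq0 subrXX.
have [e ->] := natR_subq ab; rewrite mulrAC mulr_sumr.
have powq n : q%:R * a%:R ^+ n = q%:R * b%:R ^+ n :> R.
  by rewrite -!natrX; apply: mulqR_eqmod; rewrite -modnXm (eqP ab) modnXm.
rewrite (eq_bigr (fun=> q%:R * b%:R ^+ q.-1)) => [|i _]; last first.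
  rewrite mulrA powq -mulrA -exprD subnK // -ltnS prednK ?prime_gt0 //.
by rewrite sumr_const card_ord -[X in X * _]mulr_natl mulrA mulqq !mul0r.
Qed.

Lemma quotient_mod (j k : nat) : (0 < j < q)%N -> (0 < k < q)%N ->
  exists l, [/\ (0 < l < q)%N, (k == j * l %[mod q])%N &
    [seq l <- index_iota 1 q | k == j * l %[mod q]] = [:: l]].
Proof.
move=> /andP [j0 jq] /andP [k0 kq]; have q0 := prime_gt0 pq.
have cop : coprime q j by rewrite prime_coprime // gtnNdvd.
have [u v Euv _] := egcdnP q j0.
have {}Euv : (u * j = v * q + 1)%N by rewrite Euv gcdnC (eqP cop).
pose l := (u * k %% q)%N.
have kl : (k == j * l %[mod q])%N.
  rewrite /l modnMmr mulnA (mulnC j) Euv.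
  by rewrite mulnDl mul1n mulnAC modnMDl.
have l0 : (0 < l < q)%N.
  rewrite ltn_mod q0 andbT lt0n; apply: contraTneq kl => ->.
  by rewrite muln0 mod0n modn_small // -lt0n.
exists l; split => //; apply: perm_small_eq => //; apply: uniq_perm => //.
  by rewrite filter_uniq ?iota_uniq.
move=> i; rewrite mem_filter mem_index_iota inE.
apply/andP/eqP => [[ki /andP [i0 iq]]|->]; last by [].
have /andP [_ lq] := l0.
have : (j * i == j * l %[mod q])%N by rewrite -(eqP ki) kl.
wlog il : i l {kl l0} lq iq {ki i0} / (i <= l)%N => [H|].
  have [/H|/ltnW /H] := leqP i l; first exact.
  by rewrite eq_sym => H' /H' ->.
rewrite eq_sym eqn_mod_dvd ?leq_mul // -mulnBr Gauss_dvdr //.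
case: (posnP (l - i)%N) => [/eqP|d0]; last first.
  by move/(dvdn_leq d0); rewrite leqNgt (leq_ltn_trans (leq_subr _ _) lq).
by rewrite subn_eq0 => li _; apply/eqP; rewrite eqn_leq il.
Qed.

Lemma sum_quotient (V : nmodType) (j k : nat) (F : nat -> V) : (0 < j < q)%N ->
  (0 < k < q)%N -> exists l, [/\ (0 < l < q)%N, (k == j * l %[mod q])%N &
    \sum_(1 <= l < q | (k == j * l %[mod q])%N) F l = F l].
Proof.
move=> hj hk; have [l [l0 kl E]] := quotient_mod hj hk; exists l; split=> //.
by rewrite -big_filter E big_seq1.
Qed.

Lemma qinv_spec (j : nat) : (0 < j < q)%N ->
  \sum_(1 <= l < q | (1 == j * l %[mod q])%N) (j * l)%N = (j * qinv q j%:R)%N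
  /\ (1 == j * qinv q j%:R %[mod q])%N.
Proof.
move=> hj; have q1 := prime_gt1 pq.
have [l [l0 kl E]] := @quotient_mod j 1 hj q1.
suff -> : qinv q j%:R = l by rewrite -big_filter E big_seq1.
have q0 : (q%:R : rat) != 0 by rewrite pnatr_eq0 -lt0n prime_gt0.
rewrite /qinv -[l]/(head 0%N [:: l]) -E /index_iota subn1; congr head.
apply: eq_filter => i; have -> : j%:R * i%:R - 1 = ((j * i)%N%:Z - 1)%:~R :> rat.
  by rewrite intrB -natrM.
rewrite eq_sym -[in RHS]eqz_nat -!modz_nat eqz_mod_dvd unfold_in expr1.
apply/idP/idP => [/ZlocP [a [s [qs]]]|/dvdzP [b ->]].
  move/eqP; rewrite eqr_div ?intr_eq0 //; last first.
    by apply: contraNneq qs => ->; rewrite dvdz0.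
  rewrite -[q%:R]/(q%:~R) -!intrM eqr_int => /eqP Es.
  have : (q%:Z %| ((j * i)%N%:Z - 1) * s)%Z by rewrite Es dvdz_mull.
  by rewrite !dvdzE abszM Euclid_dvdM // -!dvdzE (negPf qs) orbF.
by rewrite intrM mulfK //; have [] := Zloc_modq2_int pq b.
Qed.

Lemma natR_unit (m : nat) : (0 < m < q)%N -> (m%:R : R) \is a GRing.unit.
Proof.
by case/andP => m0 mq; rewrite -[m%:R]/(m%:~R) intR_unit // gtnNdvd.
Qed.

(** As m^q is the Teichmueller representative of m modulo q^2, this is the factor
    of m that is congruent to 1 modulo q. *)
Definition oneunit (m : nat) : R := m%:R / m%:R ^+ q.

Lemma oneunitK m : (0 < m < q)%N -> m%:R = m%:R ^+ q * oneunit m :> R.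
Proof. by move=> hm; rewrite mulrC divrK // unitrX // natR_unit. Qed.

(** (u - 1) (v - 1) is a multiple of q^2. *)
Lemma oneunitM a b : (0 < a < q)%N -> (0 < b < q)%N ->
  oneunit a * oneunit b = oneunit a + oneunit b - 1.
Proof.
have sub1 m : (0 < m < q)%N -> exists e, oneunit m - 1 = q%:R * e.
  move=> hm; have um : (m%:R ^+ q : R) \is a GRing.unit by rewrite unitrX ?natR_unit.
  have [e E] : exists e : int, m%:R - (m ^ q)%N%:R = q%:R * e%:~R :> R.
    by apply: natR_subq; rewrite eq_sym; apply/eqP/fermat_little.
  exists (e%:~R / m%:R ^+ q); apply: (mulIr um).
  by rewrite mulrBl mul1r mulrA !divrK // -E natrX.
move=> /sub1 [d Ed] /sub1 [e Ee]; apply/eqP; rewrite -subr_eq0.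
have -> : oneunit a * oneunit b - (oneunit a + oneunit b - 1)
  = (oneunit a - 1) * (oneunit b - 1) by ring.
by rewrite Ed Ee mulrACA mulqq mul0r.
Qed.

Definition pairsum (k : nat) : nat :=
  \sum_(1 <= j < q) \sum_(1 <= l < q | (k == j * l %[mod q])%N) j * l.

Lemma pairsum1 : pairsum 1 = cq q.
Proof.
rewrite /pairsum /cq; rewrite !big_nat; apply: eq_bigr => j hj.
by have [] := qinv_spec hj.
Qed.

(** For fixed k each j determines l, and conversely, so that summing
    u_j + u_l - 1 over the pairs gives a value independent of k. *)
Lemma pairsumE k : (0 < k < q)%N -> (pairsum k)%:R =
  k%:R ^+ q * ((\sum_(1 <= j < q) oneunit j) *+ 2 - q.-1%:R) :> R.
Proof.
move=> hk; rewrite /pairsum natr_sum.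
pose rel j l := (k == j * l %[mod q])%N.
have sum1 (F : nat -> R) :
    \sum_(1 <= j < q) \sum_(1 <= l < q | rel j l) F j = \sum_(1 <= j < q) F j.
  rewrite !big_nat; apply: eq_bigr => j hj.
  by have [l [_ _ ->]] := sum_quotient (fun=> F j) hj hk.
transitivity (\sum_(1 <= j < q) \sum_(1 <= l < q | rel j l)
    k%:R ^+ q * (oneunit j + oneunit l - 1)).
  rewrite !big_nat; apply: eq_bigr => j hj; rewrite natr_sum.
  rewrite big_nat_cond [RHS]big_nat_cond; apply: eq_bigr => l /andP [hl kl].
  rewrite -oneunitM // (expq_eqmod kl) natrM exprMn.
  by rewrite {1}(oneunitK hj) {1}(oneunitK hl); ring.
under eq_bigr => j _ do rewrite -mulr_sumr sumrB big_split /=.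
rewrite -mulr_sumr sumrB big_split /= !sum1.
have -> : \sum_(1 <= j < q) \sum_(1 <= l < q | rel j l) oneunit l
        = \sum_(1 <= j < q) oneunit j.
  rewrite -[RHS]sum1 (exchange_big_dep xpredT) //=; apply: eq_bigr => j _.
  by apply: eq_bigl => l; rewrite /rel mulnC.
by rewrite big_const_nat iter_addr_0 subn1 mulr2n.
Qed.

Lemma pairsum_modq2 k : (0 < k < q)%N -> (pairsum k)%:R = k%:R ^+ q * (cq q)%:R :> R.
Proof.
move=> hk; have h1 : (0 < 1 < q)%N by rewrite prime_gt1.
by rewrite -pairsum1 !pairsumE // expr1n mul1r.
Qed.

(** Each of the q-1 terms j j^* of c_q is 1 modulo q. *)
Lemma mulq_cq : q%:R * (cq q)%:R = - q%:R :> R.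
Proof.
rewrite /cq natr_sum mulr_sumr big_nat (eq_bigr (fun=> q%:R)) => [|j hj].
  rewrite -big_nat big_const_nat iter_addr_0 mulrnBr ?prime_gt0 // mulr1n.
  by rewrite -[X in X - _]mulr_natr mulqq sub0r.
have [_ H] := qinv_spec hj.
by rewrite -(mulqR_eqmod H) mulr1.
Qed.

Lemma cq_unit : ((cq q)%:R : R) \is a GRing.unit.
Proof.
have : q%:R * ((cq q)%:Z + 1)%:~R == 0 :> R.
  by rewrite intrD -[_%:Z%:~R]/((cq q)%:R) mulrDr mulq_cq mulr1 addNr.
rewrite mulqR_eq0 // -[(cq q)%:R]/((cq q)%:~R) intR_unit //=.
move=> qc; apply/negP => qc'.
by move: qc; rewrite dvdn_addr // dvdn1 eqn_leq leqNgt prime_gt1.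
Qed.
End NumberTheory.

(** * The congruence between f_q and the polylogarithm *)

Section Congruence.
Variables (q : nat) (pq : prime q) (q3 : (3 <= q)%N).
Local Notation R := 'Z_(q ^ 2).
Local Notation P := (lipoly q.-1).

Lemma coef_fq t : (fq q)`_t = if (0 < t <= q)%N then
  (\sum_(1 <= k < q) (-1) ^+ k * 'C(t, k)%:R * (pairsum q k)%:R) / t%:R else 0.
Proof.
rewrite /fq coef_sum; under eq_bigr => i _ do rewrite coefZ coefXn.
have E i : \sum_(1 <= j < q) \sum_(1 <= k < q)
      \sum_(1 <= l < q | (k == j * l %[mod q])%N)
          (-1) ^+ k * 'C(i, k)%:R * j%:R * l%:R
  = \sum_(1 <= k < q) (-1) ^+ k * 'C(i, k)%:R * (pairsum q k)%:R :> rat.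
  rewrite exchange_big; apply: eq_bigr => k _ /=.
  rewrite /pairsum natr_sum mulr_sumr; apply: eq_bigr => j _.
  rewrite natr_sum mulr_sumr; apply: eq_bigr => l _.
  by rewrite natrM !mulrA.
under eq_bigr => i _ do rewrite E.
case: ifP => ht; last first.
  rewrite big_nat big1 // => i hi; case: eqP => [ti|_]; last by rewrite mulr0.
  by rewrite ti -[X in _ && X]ltnS hi in ht.
rewrite (bigD1_seq t) /= ?iota_uniq ?mem_index_iota //.
rewrite eqxx mulr1 [X in _ + X]big1 ?addr0 // => i /negPf it.
by rewrite eq_sym it mulr0.
Qed.

Lemma coef_lipolyQ t : (0 < t <= q)%N -> (PolyQ P)`_t =
  (\sum_(1 <= k < q.+1) (-1) ^+ k * 'C(t, k)%:R * k%:R ^+ q) / t%:R.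
Proof.
move=> /andP [t0 tq]; have t0' : (t%:R : rat) != 0 by rewrite pnatr_eq0 -lt0n.
apply: (mulfI t0'); rewrite mulrC [RHS]mulrC divfK // mulrC coef_map /=.
have -> : t%:R = (t%:R : int)%:~R :> rat by rewrite rmorph_nat.
rewrite -intrM coef_lipoly prednK ?prime_gt0 //.
rewrite rmorph_sum /= -(big_mkord xpredT
  (fun j => ((-1) ^+ j * 'C(t, j)%:R * j%:R ^+ q : int)%:~R)).
(* The term j = 0 vanishes, and so do the terms with t < j <= q. *)
rewrite big_ltn // expr0n eqn0Ngt prime_gt0 // !mulr0 add0r.
rewrite [RHS](@big_cat_nat _ _ _ t.+1) //= [X in _ = _ + X]big_nat.
rewrite [X in _ = _ + X]big1 => [|j /andP [tj _]]; last first.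
  by rewrite bin_small // mulr0 mul0r.
rewrite addr0; apply: eq_bigr => j _.
by rewrite !intrM !rmorphXn rmorphN1 /= !rmorph_nat.
Qed.

(** Since C(t,k)/t = C(t-1,k-1)/k, dividing by t costs no power of q, even for
    t = q, as long as k < q; the term k = q only occurs in P, and there q^q/q is
    divisible by q^2. *)
Lemma fq_congr : fq q - (cq q)%:R *: PolyQ P \is a polyOver (qZloc q 2).
Proof.
have q0 := prime_gt0 pq.
apply/(all_nthP 0) => t _ /=; rewrite coefB coefZ coef_fq.
case: ifP => [ht|]; last first.
  move=> ht; suff -> : (PolyQ P)`_t = 0 by rewrite mulr0 subr0 qZloc0.
  rewrite coef_map /=; case: t ht => [|t] /=; first by rewrite lipoly_coef0.
  move/negbT; rewrite -ltnNge ltnS => ht.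
  by rewrite (leq_sizeP _ _ (size_lipoly q.-1)) // prednK.
rewrite coef_lipolyQ // mulrA -mulrBl big_nat_recr //= mulrDr mulr_sumr.
rewrite opprD addrA -sumrB mulrDl mulr_suml.
have [t0 tq] := andP ht.
have binE k : (0 < k)%N -> 'C(t, k)%:R / t%:R = 'C(t.-1, k.-1)%:R / k%:R :> rat.
  case: k => // k _; apply/eqP; rewrite eqr_div ?pnatr_eq0 -?lt0n //.
  by rewrite -!natrM mulnC -mul_bin_diag mulnC.
have zn (n : int) : n%:~R \in Zloc q by have [] := Zloc_modq2_int pq n.
apply: qZlocD => //.
  rewrite big_nat; apply: qZloc_sum => // k hk; have [k0 kq] := andP hk.
  pose u : int := (pairsum q k)%:Z - (cq q * k ^ q)%N%:Z.
  have -> : ((-1) ^+ k * 'C(t, k)%:R * (pairsum q k)%:R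
      - (cq q)%:R * ((-1) ^+ k * 'C(t, k)%:R * k%:R ^+ q)) / t%:R
     = u%:~R * (((-1) ^+ k * 'C(t.-1, k.-1)%:Z)%:~R / k%:~R) :> rat.
    transitivity ((-1) ^+ k * ((pairsum q k)%:R - (cq q)%:R * k%:R ^+ q)
                  * ('C(t, k)%:R / t%:R) : rat); first by ring.
    rewrite binE // /u !(intrB, intrM) rmorphXn rmorphN1 /= !PoszM !intrM -!pmulrn.
    by rewrite natrX; ring.
  apply: qZlocM => //; last first.
    by apply/ZlocP; exists ((-1) ^+ k * 'C(t.-1, k.-1)%:Z), k; rewrite dvdzE /= gtnNdvd.
  have [zu mu] := Zloc_modq2_int pq u; rewrite qZloc2E // zu mu /u intrB.
  rewrite -[(pairsum q k)%:~R]/((pairsum q k)%:R) pairsum_modq2 //.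
  by rewrite -[(cq q * _)%N%:~R]/((cq q * k ^ q)%N%:R) natrM natrX mulrC subrr.
have -> : - ((cq q)%:R * ((-1) ^+ q * 'C(t, q)%:R * q%:R ^+ q)) / t%:R
  = (q ^ 2)%N%:R * (- (cq q)%:R * ((-1) ^+ q * 'C(t.-1, q.-1)%:R * q%:R ^+ (q - 3))) :> rat.
  transitivity (- ((cq q)%:R * ((-1) ^+ q * q%:R ^+ q)) * ('C(t, q)%:R / t%:R) : rat).
    by ring.
  (* One factor q cancels the denominator of C(t-1,q-1)/q, two remain. *)
  have -> : q%:R ^+ q = q%:R ^+ (q - 3) * q%:R ^+ 3 :> rat by rewrite -exprD subnK.
  rewrite binE // natrX.
  have q0' : (q%:R : rat) != 0 by rewrite pnatr_eq0 -lt0n.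
  by field.
rewrite -[(q ^ 2)%N%:R]/((q ^ 2)%N%:~R).
have [zq2 mq2] := Zloc_modq2_int pq (q ^ 2)%N.
apply: qZlocM => //.
  by rewrite qZloc2E // zq2 mq2 -[_%:~R]/((q ^ 2)%N%:R) pchar_Zp ?q2_gt1 ?eqxx.
have -> : - (cq q)%:R * ((-1) ^+ q * 'C(t.-1, q.-1)%:R * q%:R ^+ (q - 3))
 = (- (cq q)%:Z * ((-1) ^+ q * 'C(t.-1, q.-1)%:Z * q%:Z ^+ (q - 3)))%:~R :> rat.
  by rewrite !intrM rmorphN !rmorphXn rmorphN1.
exact: zn.
Qed.

(** * The map a - f_q(a) on Z/q^2 *)

Lemma horner_taylor1 (S : comNzRingType) (p : {poly S}) (x h : S) : h * h = 0 ->
  p.[x + h] = p.[x] + p^`().[x] * h.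
Proof.
move=> h2; elim/poly_ind: p => [|p c IH]; first by rewrite deriv0 !horner0 mul0r addr0.
rewrite derivMXaddC !hornerMXaddC hornerD hornerMX IH.
transitivity (p.[x] * x + c + (p.[x] + p^`().[x] * x) * h + p^`().[x] * (h * h)).
  by ring.
by rewrite h2 mulr0 addr0.
Qed.

Local Notation p := (map_poly (intr : int -> R) P).

(** Modulo q the exponent k+1 = q in [coef_lipoly] can be replaced by 1, so that
    P_(q-1) and P_0 = -X have the same derivative. *)
Lemma mulq_deriv_lipoly x : q%:R * p^`().[x] = - q%:R :> R.
Proof.
suff E : q%:R *: p^`() = (- q%:R)%:P by rewrite -hornerZ E hornerC.
have -> : (- q%:R)%:P = q%:R *: (map_poly (intr : int -> R) (lipoly 0))^`().
  have -> : map_poly (intr : int -> R) (lipoly 0) = - 'X by rewrite rmorphN /= map_polyX.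
  by rewrite derivN derivX scalerN polyCN alg_polyC.
apply/polyP => i; rewrite !coefZ !coef_deriv !coef_map /= -!rmorphMn /=.
rewrite -[- 'X]/(lipoly 0) -!(mulr_natl (lipoly _)`__) !coef_lipoly prednK ?prime_gt0 //.
rewrite !rmorph_sum !mulr_sumr; apply: eq_bigr => j _ /=.
rewrite !intrM !rmorphXn rmorphN1 /= !rmorph_nat expr1 !(mulrCA q%:R); congr (_ * _).
by rewrite -natrX; apply: mulqR_eqmod; rewrite // fermat_little.
Qed.

(** The map a - f_q(a) of the definition of S_q, extended to all of Z/q^2. *)
Definition sub_fqR (r : R) : R := r - (cq q)%:R * p.[r].

(** By Taylor's formula the two changes cancel: c_q P(r + q s) is
    c_q P(r) + q s modulo q^2, because both c_q and P' are -1 modulo q. *)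
Lemma sub_fqR_addq r s : sub_fqR (r + q%:R * s) = sub_fqR r.
Proof.
rewrite /sub_fqR horner_taylor1; last by rewrite mulrACA mulqq // mul0r.
rewrite mulrA [_ * q%:R]mulrC mulq_deriv_lipoly mulrDr mulNr mulrN mulrA.
by rewrite [_ * q%:R]mulrC mulq_cq // mulNr opprK opprD addrACA subrr addr0.
Qed.

Lemma q_odd : odd q.
Proof. by case: (even_prime pq) q3 => // ->. Qed.

Lemma pred_even : ~~ odd q.-1.
Proof. by rewrite -oddS prednK ?prime_gt0 ?q_odd. Qed.

Lemma pred_gt0 : (0 < q.-1)%N.
Proof. by rewrite -ltnS prednK ?(ltn_trans _ q3). Qed.

Lemma sub_fqR_refl r : sub_fqR (1 - r) = 1 - sub_fqR r.
Proof. by rewrite /sub_fqR (horner_lipoly_refl _ pred_even pred_gt0); ring. Qed.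

Lemma fq_refl : (fq q \Po (1 - 'X)) - (- fq q) \is a polyOver (qZloc q 2).
Proof.
have oneX : map_poly (intr : int -> rat) (1 - 'X) = 1 - 'X.
  by rewrite rmorphB rmorph1 /= map_polyX.
have Pr : PolyQ P \Po (1 - 'X) = - PolyQ P.
  have := congr1 (map_poly (intr : int -> rat)) (lipoly_refl_even pred_even pred_gt0).
  by rewrite map_comp_poly oneX rmorphN.
have := qZloc_comp pq (1 - 'X) fq_congr; have := fq_congr.
rewrite oneX; set err := fq q - _ => qe qc.
have -> : fq q \Po (1 - 'X) - - fq q = (err \Po (1 - 'X)) + err.
  by rewrite /err comp_polyB comp_polyZ Pr scalerN; ring.
exact: qZloc_polyD.
Qed.

Lemma fq_horner x : x \in Zloc q ->
  (fq q).[x] \in Zloc q /\ modq2 q (fq q).[x] = (cq q)%:R * p.[modq2 q x].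
Proof.
move=> zx; have q_err := qZloc_horner pq fq_congr zx.
have [zP mP] := Zloc_modq2_horner pq P zx.
have [zc mc] := Zloc_modq2_int pq (cq q).
have [zcP mcP] := Zloc_modq2M pq zc zP.
have -> : (fq q).[x] = (fq q - (cq q)%:R *: PolyQ P).[x] + (cq q)%:~R * (PolyQ P).[x].
  by rewrite hornerD hornerN hornerZ subrK.
have [-> ->] := Zloc_modq2D pq (qZlocW pq q_err) zcP.
by move: q_err; rewrite qZloc2E // => /andP [_ /eqP ->]; rewrite add0r mcP mc mP.
Qed.

(** Periodicity modulo q removes the restriction to a = 0, ..., q-1. *)
Lemma in_Sq (r : R) : r \in Sq q <-> exists s, r = sub_fqR s.
Proof.
have mS (a : nat) : modq2 q (a%:R - (fq q).[a%:R]) = sub_fqR a%:R.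
  have [za ma] := Zloc_modq2_int pq a.
  have [zf mf] := fq_horner za.
  by have [_ ->] := Zloc_modq2B pq za zf; rewrite mf ma.
split=> [/imsetP [a _ ->]|[s ->]]; first by exists (a : nat)%:R; rewrite mS.
apply/imsetP; exists (Ordinal (ltn_pmod s (prime_gt0 pq))) => //=.
rewrite mS -[s in LHS]natr_Zp [in LHS](divn_eq s q) addnC natrD mulnC natrM.
exact: sub_fqR_addq.
Qed.

Lemma natR2_unit : (2%:R : R) \is a GRing.unit.
Proof. by apply: natR_unit. Qed.

Lemma lipoly_half r : r = 1 - r -> p.[r] = 0.
Proof.
move=> rE; have := horner_lipoly_refl r pred_even pred_gt0; rewrite -rE => /eqP.
rewrite -addr_eq0 -mulr2n -mulr_natl => /eqP E.
by apply: (mulrI natR2_unit); rewrite E mulr0.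
Qed.
End Congruence.

(** * Values of the polylogarithm *)

Section Values.
Variables (q : nat) (pq : prime q) (q3 : (3 <= q)%N).
Local Notation R := 'Z_(q ^ 2).
Local Notation P := (lipoly q.-1).
Local Notation p := (map_poly (intr : int -> R) P).

Lemma fval_Lineg_qZloc b : b != 1 -> b / (b - 1) \in Zloc q ->
  (fval (Lineg q.-1) b \in qZloc q 2) = (p.[modq2 q (b / (b - 1))] == 0).
Proof.
move=> b1 zb; rewrite fval_Lineg // qZloc2E //.
by have [-> ->] := Zloc_modq2_horner pq P zb.
Qed.

Lemma fval_Lineg_inv b : b != 0 -> b != 1 ->
  fval (Lineg q.-1) b^-1 = - fval (Lineg q.-1) b.
Proof.
move=> b0 b1; rewrite !fval_Lineg ?invr_eq1 //.
have b1' : 1 - b != 0 by rewrite subr_eq0 eq_sym.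
rewrite (mobius_inv b0 b1').
exact: (horner_lipoly_refl _ (pred_even pq q3) (pred_gt0 q3)).
Qed.

Lemma fval_Lineg_qZlocV b : b != 0 -> b != 1 ->
  (fval (Lineg q.-1) b^-1 \in qZloc q 2) = (fval (Lineg q.-1) b \in qZloc q 2).
Proof.
move=> b0 b1; rewrite fval_Lineg_inv //; apply/idP/idP; last exact: qZlocN.
by rewrite -{2}[fval _ b]opprK; apply: qZlocN.
Qed.

Lemma fval_Lineg0 b : b \in qZloc q 2 -> fval (Lineg q.-1) b \in qZloc q 2.
Proof.
rewrite qZloc2E // => /andP [zb /eqP mb].
have [|b1 z m] := Zloc_mobius pq zb; first by rewrite mb sub0r unitrN unitr1.
rewrite fval_Lineg_qZloc // m mb mul0r horner_coef0 coef_map /=.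
by rewrite lipoly_coef0.
Qed.

Lemma fval_LinegN1 b : b - (-1) \in qZloc q 2 -> fval (Lineg q.-1) b \in qZloc q 2.
Proof.
rewrite opprK qZloc2E // => /andP [zb1 /eqP mb1].
have [z1 m1] := Zloc_modq2_1 pq.
have [] := Zloc_modq2B pq zb1 z1; rewrite addrK mb1 m1 sub0r => zb mb.
have u2 : (-1 - 1 : R) \is a GRing.unit by rewrite -opprD unitrN natR2_unit.
have [|b1 z m] := Zloc_mobius pq zb; first by rewrite mb.
rewrite fval_Lineg_qZloc // m mb lipoly_half //.
apply: (mulIr u2); rewrite mulrBl divrK // mul1r; ring.
Qed.

Lemma in_Sq_onem b : b \in Zloc q -> modq2 q b \in Sq q -> modq2 q (1 - b) \in Sq q.
Proof.
move=> zb; have [z1 m1] := Zloc_modq2_1 pq.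
have [_ ->] := Zloc_modq2B pq z1 zb.
by rewrite m1 !in_Sq // => -[r ->]; exists (1 - r); rewrite sub_fqR_refl.
Qed.
End Values.

Theorem theorem5p4 (q : nat) (q_prime : prime q) (q_ge3 : (3 <= q)%N) :
  let Li := Lineg q.-1 in
  let f := fq q in
  let x := 'X%:FR : {fraction {poly rat}} in
  (* (1) *)
  (exists P : {poly int},
     fcomp Li (- x / (1 - x)) = (map_poly intr P)%:FR /\
     f - (cq q)%:R *: map_poly intr P \is a polyOver (qZloc q 2)) /\
  (* (2) *)
  (forall m n : int, m != 0 -> ~~ (q%:Z %| m - n)%Z ->
     (fval Li (n%:~R / m%:~R) \in qZloc q 2 <->
      f.[- n%:~R / (m - n)%:~R] \in qZloc q 2)) /\
  (* (3) *)
  (fcomp Li x^-1 = - Li /\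
   (f \Po (1 - 'X)) - (- f) \is a polyOver (qZloc q 2)) /\
  (* (3)(a) *)
  (forall b : rat, b != 0 -> b != 1 ->
     (fval Li b \in qZloc q 2 <-> fval Li b^-1 \in qZloc q 2)) /\
  (* (3)(b) *)
  (forall b : rat, b \in Zloc q ->
     (modq2 q b \in Sq q <-> modq2 q (1 - b) \in Sq q)) /\
  (* (3)(c) *)
  (forall m n : int, m != 0 ->
     [\/ n%:~R / m%:~R \in qZloc q 2,
         n%:~R / m%:~R - (-1) \in qZloc q 2 |
         n != 0 /\ m%:~R / n%:~R \in qZloc q 2] ->
     fval Li (n%:~R / m%:~R) \in qZloc q 2) /\
  (* (3)(d) *)
  [/\ modq2 q 0 \in Sq q, modq2 q (1 / 2%:R) \in Sq q & modq2 q 1 \in Sq q].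
Proof.
have [z0 m0] := Zloc_modq2_int q_prime 0.
have [z1 m1] := Zloc_modq2_1 q_prime.
have Sq0 : modq2 q 0 \in Sq q.
  rewrite m0 in_Sq //; exists 0.
  by rewrite /sub_fqR horner_coef0 coef_map /= lipoly_coef0 mulr0 subr0.
move=> Li f x.
refine (conj _ (conj _ (conj (conj _ _) (conj _ (conj _ (conj _ _)))))).
- exists (lipoly q.-1); split; first exact: fcomp_Lineg_mobius.
  exact: fq_congr.
- move=> m n mn0 qmn.
  have mQ0 : (m%:~R : rat) != 0 by rewrite intr_eq0.
  have mn1 : m - n != 0 by apply: contraNneq qmn => ->; rewrite dvdz0.
  have mnQ0 : (m%:~R - n%:~R : rat) != 0 by rewrite -intrB intr_eq0.
  have zy : - n%:~R / (m - n)%:~R \in Zloc q.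
    by apply/ZlocP; exists (- n), (m - n); rewrite intrN.
  have bE : n%:~R / m%:~R / (n%:~R / m%:~R - 1) = - n%:~R / (m - n)%:~R :> rat.
    rewrite intrB; field; rewrite mQ0 mnQ0 /=.
    by rewrite mulN1r -oppr_eq0 opprB.
  rewrite /Li fval_Lineg_qZloc ?bE //; last first.
    rewrite -subr_eq0 -(mulrI_eq0 _ (mulfI mQ0)) mulrBr mulrCA divff // !mulr1.
    by rewrite -oppr_eq0 opprB.
  rewrite /f qZloc2E //; have [-> ->] := fq_horner q_prime q_ge3 zy.
  by rewrite /= (mulrI_eq0 _ (mulrI (cq_unit q_prime))).
- exact: fcomp_Lineg_inv (pred_even q_prime q_ge3) (pred_gt0 q_ge3).
- exact: fq_refl.
- by move=> b b0 b1; rewrite /Li fval_Lineg_qZlocV.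
- move=> b zb; split; first exact: in_Sq_onem.
  rewrite -{2}[b](subKr 1); apply: in_Sq_onem => //.
  by have [] := Zloc_modq2B q_prime z1 zb.
- move=> m n mn0 [|| [n0 qmn]].
  + exact: fval_Lineg0.
  + exact: fval_LinegN1.
  rewrite -invf_div /Li fval_Lineg_qZlocV ?fval_Lineg0 //.
    by rewrite mulf_neq0 ?invr_eq0 ?intr_eq0.
  move: qmn; rewrite qZloc2E // => /andP [_ H].
  by apply: contraTneq H => ->; rewrite m1 oner_eq0.
- split; [exact: Sq0 | | by rewrite -[1](subr0 1); apply: in_Sq_onem].
  have u2 := natR2_unit q_prime q_ge3.
  rewrite -[1 : rat]/(1%:~R) -[2%:R : rat]/(2%:~R) modq2_frac //; last first.
    by rewrite dvdzE /= gtnNdvd.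
  rewrite in_Sq //; exists (1%:~R / 2%:~R).
  rewrite /sub_fqR lipoly_half ?mulr0 ?subr0 //.
  by apply: (mulIr u2); rewrite mulrBl divrK // mul1r; ring.
Qed.
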